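(* Let $H$ be a real Hilbert space, let $\mathcal F:H\rightrightarrows H$ be maximal monotone, and let $D:H\to H$ be a monotone bounded linear operator. Put $\mathcal B:=(\mathcal F^{-1}+D)^{-1}$. Let $x\in H$ and $\gamma>0$. Then $y=J_{\gamma\mathcal B}(x)$ if and only if $y=E\big(\gamma J^E_{\mathcal F}(Ex)+Dx\big)$, where $E:=(\gamma I+D)^{-1}$ is a positive definite bounded linear operator.
   Context: For a set-valued map $\mathcal F:H\rightrightarrows H$, $\mathcal F^{-1}(y)=\{x: y\in\mathcal F(x)\}$. $\mathcal F$ is monotone if $\langle x^*-y^*,x-y\rangle\ge 0$ for all $x^*\in\mathcal F(x)$, $y^*\in\mathcal F(y)$, and maximal monotone if moreover its graph is not strictly contained in the graph of another monotone operator. The resolvent of $\mathcal F$ is $J_{\mathcal F}=(I+\mathcal F)^{-1}$. For a positive definite bounded linear operator $E$ (i.e. there is $c>0$ with $\langle Ex,x\rangle\ge c\|x\|^2$ for all $x$; symmetry is not required), the resolvent of $\mathcal F$ with respect to $E$ is $J^E_{\mathcal F}=(E+\mathcal F)^{-1}$, which is single-valued with full domain when $\mathcal F$ is maximal monotone. *)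

(* Defs.v *)
From HB Require Import structures.
From mathcomp Require Import all_boot all_order all_algebra.
From mathcomp Require Import all_classical all_reals all_analysis.

Set Implicit Arguments.
Unset Strict Implicit.
Unset Printing Implicit Defensive.

Import Order.TTheory GRing.Theory Num.Theory.
Import numFieldNormedType.Exports.

Local Open Scope classical_set_scope.
Local Open Scope ring_scope.

(* A real Hilbert space is a complete normed module H over R : realType with a
   positive definite symmetric bilinear form ip : {dot H for idfun} such that
   ip u u = `|u| ^+ 2.  A set-valued map on H is a function H -> set H. *)

Section SetValuedMaps.
Variables (R : realType) (H : completeNormedModType R).
Implicit Types F G : H -> set H.

Definition setmap_graph F : set (H * H) := [set p | F p.1 p.2].

Definition setmap_inv F : H -> set H := fun y => [set x | F x y].

Definition setmap_add F G : H -> set H :=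
  fun x => [set u + v | u in F x & v in G x].

Definition setmap_scale (a : R) F : H -> set H :=
  fun x => [set a *: u | u in F x].

(* [G = setmap_of_fun f] says that G is single-valued with full domain, and
   that f is the corresponding function. *)
Definition setmap_of_fun (f : H -> H) : H -> set H := fun x => [set f x].

Definition resolvent_wrt (E : H -> H) F : H -> set H :=
  setmap_inv (setmap_add (setmap_of_fun E) F).

Definition resolvent F : H -> set H :=
  setmap_inv (setmap_add (setmap_of_fun idfun) F).

Definition bounded_operator (f : H -> H) : Prop :=
  exists M : R, forall x, `|f x| <= M * `|x|.

Variable ip : {dot H for (@idfun R)}.

Definition setmap_monotone F : Prop :=
  forall x y x' y', F x x' -> F y y' -> 0 <= ip (x' - y') (x - y).

Definition setmap_maximal_monotone F : Prop :=
  setmap_monotone F /\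
  forall G, setmap_monotone G -> ~ (setmap_graph F `<` setmap_graph G).

Definition positive_definite (E : H -> H) : Prop :=
  exists2 c : R, 0 < c & forall x, c * `|x| ^+ 2 <= ip (E x) x.

End SetValuedMaps.

(* Main.v *)
(* The algebra is a change of variables: if b = (x - y) / gamma and y = u + D b
   with b in F u, then applying gamma I + D gives gamma y + D y = gamma u + D x
   and b = E x - E u, so u = (E + F)^-1 (E x).

   The analytic content is that E + F is surjective.  Minty's theorem: the
   balls with centre (u - v) / 2 and radius |u + v| / 2, for (u, v) in the
   graph of F, have a common point.  It is the limit of (u - v) / 2 along a
   minimizing sequence of q + |u - v|^2 / 4 over the epigraph of the conjugate
   of the Fitzpatrick function, where this functional is nonnegative since F is
   monotone; strong convexity makes the sequence Cauchy, and comparison with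
   the graph points gives membership in all the balls.  The nonsymmetric E is
   then handled by Banach's fixed point theorem for
   u |-> (I + lam F)^-1 (u - lam E u + lam z), and the case F = 0 of that
   argument inverts gamma I + D. *)
Require Import Defs.
From HB Require Import structures.
From mathcomp Require Import all_boot all_order all_algebra.
From mathcomp Require Import all_classical all_reals all_analysis.
From mathcomp Require Import ring lra.

Set Implicit Arguments.
Unset Strict Implicit.
Unset Printing Implicit Defensive.

Import Order.TTheory GRing.Theory Num.Theory.
Import numFieldNormedType.Exports.

Local Open Scope classical_set_scope.
Local Open Scope ring_scope.

Section Hilbert.
Variables (R : realType) (H : completeNormedModType R).
Variable ip : {dot H for (@idfun R)}.
Hypothesis ip_norm : forall u : H, ip u u = `|u| ^+ 2.
Implicit Types (u v w x y z : H) (F G : H -> set H) (A : {linear H -> H}).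

(** * Calculus of the inner product *)

Lemma ipC u v : ip u v = ip v u.
Proof. by rewrite hermC /= expr0 mul1r. Qed.

Lemma ipDl u v w : ip (u + v) w = ip u w + ip v w.
Proof. exact: linearDl. Qed.

Lemma ipNl u v : ip (- u) v = - ip u v.
Proof. exact: linearNl. Qed.

Lemma ipZl (a : R) u v : ip (a *: u) v = a * ip u v.
Proof. exact: linearZl_LR. Qed.

Lemma ipDr u v w : ip u (v + w) = ip u v + ip u w.
Proof. by rewrite ipC ipDl !(ipC u). Qed.

Lemma ipNr u v : ip u (- v) = - ip u v.
Proof. by rewrite ipC ipNl ipC. Qed.

Lemma ipZr (a : R) u v : ip u (a *: v) = a * ip u v.
Proof. by rewrite ipC ipZl ipC. Qed.

Lemma ip0r u : ip u 0 = 0.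
Proof. by rewrite -(subrr 0) ipDr ipNr subrr. Qed.

Definition ipE := (ipDl, ipDr, ipNl, ipNr, ipZl, ipZr).

Lemma ip_ge0 u : 0 <= ip u u.
Proof. by rewrite ip_norm sqr_ge0. Qed.

Lemma ip_young u v : 2 * ip u v <= ip u u + ip v v.
Proof. by have := ip_ge0 (u - v); rewrite !ipE (ipC v u); lra. Qed.

Lemma normr_le_ip u v : (`|u| <= `|v|) = (ip u u <= ip v v).
Proof. by rewrite !ip_norm ler_sqr ?nnegrE. Qed.

Lemma cauchy_seq_cvg (a : nat -> H) :
  (forall n m, `|a n - a m| <= 2 * (harmonic n + harmonic m)) -> cvgn a.
Proof.
move=> aP; apply: cauchy_cvg; apply: cauchy_exP => e e0.
have := @cvg_harmonic R => /cvgrPdist_lt /(_ (e / 4)) [|N _ NP]; first lra.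
exists (a N); exists N => // n /= Nn; rewrite -ball_normE /=.
have /= := NP N (leqnn N); have /= := NP n Nn; have := aP N n.
rewrite !sub0r !normrN !ger0_norm ?invr_ge0 ?ler0n //=.
by move: _%:R^-1 _%:R^-1 => p q; lra.
Qed.

(** * Fitzpatrick function and the common point of the balls *)

(* The epigraph of the Fitzpatrick function of [F]. *)
Definition fitz F : set (H * H * R) :=
  [set p | forall u v, F u v -> 0 <= p.2 - ip p.1.1 v - ip p.1.2 u + ip u v].

(* The epigraph of the conjugate of the Fitzpatrick function, with the two
   coordinates exchanged. *)
Definition fitz_conj F : set (H * H * R) :=
  [set p | forall u v q, fitz F (u, v, q) ->
     0 <= p.2 - ip p.1.1 v - ip p.1.2 u + q].

Lemma fitz_conj_graph F u v : F u v -> fitz_conj F (u, v, ip u v).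
Proof.
move=> Fuv u' v' q /(_ _ _ Fuv) /=; rewrite (ipC v') (ipC u'); lra.
Qed.

(** Monotonicity puts the triples [(a, b, ip a b)] of graph points in [fitz F]; testing against them
    shows that [(u, v, q)] itself lies in [fitz F]. Testing it against itself then gives twice the
    inequality. *)
Lemma fitz_conj_ge F u v q : setmap_monotone ip F ->
  fitz_conj F (u, v, q) -> ip u v <= q.
Proof.
move=> mF Cuv; suff /Cuv /= : fitz F (u, v, q).
  by rewrite (ipC v) /=; lra.
move=> u' v' Fuv' /=; apply: Cuv => a b Fab /=.
have := mF _ _ _ _ Fuv' Fab; rewrite !ipE (ipC v' u') (ipC b u') (ipC b a); lra.
Qed.

Lemma fitz_conj_conv F (t : R) u v q u' v' q' : 0 <= t <= 1 ->
  fitz_conj F (u, v, q) -> fitz_conj F (u', v', q') ->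
  fitz_conj F ((1 - t) *: u + t *: u', (1 - t) *: v + t *: v',
               (1 - t) * q + t * q').
Proof.
move=> /andP[t0 t1] C C' a b r ab /=.
have /= := C _ _ _ ab; have /= := C' _ _ _ ab; rewrite !ipE => h h'.
have ht := mulr_ge0 t0 h; have : 0 <= 1 - t by lra.
move=> /mulr_ge0 /(_ h'); nra.
Qed.

(** The subtracted square is the strong convexity gain that makes minimizing sequences Cauchy. *)
Lemma convex_comb_quad (t q : R) u v q' u' v' :
  (1 - t) * q + t * q' + 4^-1 * `|(1 - t) *: u + t *: u'
                                  - ((1 - t) *: v + t *: v')| ^+ 2
  = (1 - t) * (q + 4^-1 * `|u - v| ^+ 2) + t * (q' + 4^-1 * `|u' - v'| ^+ 2)
    - t * (1 - t) * `|2^-1 *: (u - v) - 2^-1 *: (u' - v')| ^+ 2.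
Proof.
rewrite -!ip_norm !ipE (ipC v u) (ipC v u') (ipC v v') (ipC v' u) (ipC v' u').
by rewrite (ipC u' u); field.
Qed.

Lemma monotone_related_point F : setmap_monotone ip F ->
  (exists u v, F u v) ->
  exists x, forall u v, F u v -> ip (x + v) (x - u) <= 0.
Proof.
move=> mF [u0 [v0 Fuv0]].
pose h (p : H * H * R) : R := p.2 + 4^-1 * `|p.1.1 - p.1.2| ^+ 2.
have h_graph u v : h (u, v, ip u v) = `|2^-1 *: (u + v)| ^+ 2.
  by rewrite /h /= -!ip_norm !ipE (ipC v u); field.
have h_ge0 p : fitz_conj F p -> 0 <= h p.
  case: p => [[u v] q] /(fitz_conj_ge mF) uvq.
  have := h_graph u v; have := sqr_ge0 `|2^-1 *: (u + v)|; rewrite /h /=; lra.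
have hinf : has_inf (h @` fitz_conj F).
  split; first by eexists; exact: imageP (fitz_conj_graph Fuv0).
  by exists 0 => _ [p Cp <-]; exact: h_ge0.
set s := inf (h @` fitz_conj F).
have s_le p : fitz_conj F p -> s <= h p.
  by move=> Cp; apply: (ge_inf hinf.2); exists p.
have s_ge0 : 0 <= s by apply: (lb_le_inf hinf.1) => _ [p Cp <-]; exact: h_ge0.
(* The excess is a square so that distances, obtained after a square root, are controlled by
   [harmonic] itself. *)
have /choice[p pP] : forall n : nat,
    exists p, fitz_conj F p /\ h p < s + harmonic n ^+ 2.
  move=> n; have h2 : 0 < (harmonic n : R) ^+ 2.
    by rewrite exprn_gt0 //= invr_gt0 ltr0n.
  by have [_ [p Cp <-] hp] := inf_adherent h2 hinf; exists p.
pose a n := 2^-1 *: ((p n).1.1 - (p n).1.2).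
(* Compare [s] with the value of [h] at the convex combination of [p n] and [p']. *)
have conv (t : R) n p' : 0 <= t <= 1 -> fitz_conj F p' ->
    t * (1 - t) * `|a n - 2^-1 *: (p'.1.1 - p'.1.2)| ^+ 2 <=
    (1 - t) * harmonic n ^+ 2 + t * (h p' - s).
  move=> t01 Cp'; have [] := pP n; rewrite /a.
  case: (p n) p' Cp' => [[u v] q] [[u' v'] q'] C' C hq.
  have := s_le _ (fitz_conj_conv t01 C C').
  have t1 : 0 <= 1 - t by case/andP: t01; lra.
  have := ler_wpM2l t1 (ltW hq).
  rewrite /h /= convex_comb_quad; move: (n.+1%:R^-1) => r; lra.
have a_cauchy n m : `|a n - a m| <= 2 * (harmonic n + harmonic m).
  have t01 : 0 <= (2^-1 : R) <= 1 by lra.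
  have [Cm hm] := pP m; have := conv _ n _ t01 Cm; rewrite -/(a m) => h1.
  have hn0 : 0 <= harmonic n :> R by rewrite invr_ge0.
  have hm0 : 0 <= harmonic m :> R by rewrite invr_ge0.
  rewrite -ler_sqr ?nnegrE ?mulr_ge0 ?addr_ge0 //.
  move: hm h1; rewrite -/(harmonic _).
  by move: (harmonic n) (harmonic m) hn0 hm0 => r1 r2; nra.
have /cvg_ex[/= x ax] := cauchy_seq_cvg a_cauchy.
exists x => u v Fuv.
have ball : `|x - 2^-1 *: (u - v)| ^+ 2 <= `|2^-1 *: (u + v)| ^+ 2.
  (* Take [t] equal to [harmonic n], the square root of the excess: after division by [t] the error
     is still of order [harmonic n]. *)
  have b n : (1 - harmonic n) * `|a n - 2^-1 *: (u - v)| ^+ 2 <=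
             `|2^-1 *: (u + v)| ^+ 2 + harmonic n.
    have h01 : 0 <= (harmonic n : R) <= 1.
      by rewrite invr_ge0 ler0n /= invf_le1 ?ltr0n // ler1n.
    have h0 : 0 < (harmonic n : R) by rewrite invr_gt0 ltr0n.
    have := conv _ n _ h01 (fitz_conj_graph Fuv).
    rewrite h_graph /= -/(harmonic n) => h1.
    rewrite -(ler_pM2l h0); move: h1.
    have := mulr_ge0 (ltW h0) s_ge0; have := exprn_ge0 3 (ltW h0).
    by rewrite /=; move: (n.+1%:R^-1) => r; lra.
  have l1 : (1 - harmonic n) * `|a n - 2^-1 *: (u - v)| ^+ 2 @[n --> \oo]
      --> `|x - 2^-1 *: (u - v)| ^+ 2.
    rewrite -[X in _ --> X]mul1r -[X in X * _](subr0 1).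
    apply: cvgM; first by apply: cvgB; [exact: cvg_cst|exact: cvg_harmonic].
    by rewrite expr2; apply: cvgM; apply: cvg_norm;
      (apply: cvgB; [exact: ax|exact: cvg_cst]).
  have l2 : `|2^-1 *: (u + v)| ^+ 2 + harmonic n @[n --> \oo]
      --> `|2^-1 *: (u + v)| ^+ 2.
    rewrite -[X in _ --> X]addr0.
    by apply: cvgD; [exact: cvg_cst|exact: cvg_harmonic].
  by apply: (ler_cvg_to l1 l2); exact: nearW.
(* Expanding the squares, membership in the ball is exactly [ip (x + v) (x - u) <= 0]. *)
by move: ball; rewrite -!ip_norm !ipE (ipC v u) (ipC v x) (ipC u x); nra.
Qed.

(** * Maximality and Minty's theorem *)

Lemma maximal_monotone_mem F x y : setmap_maximal_monotone ip F ->
  (forall u v, F u v -> 0 <= ip (y - v) (x - u)) -> F x y.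
Proof.
move=> [mF maxF] xy; apply: contrapT => nFxy.
(* Adjoining [(x, y)] to the graph keeps it monotone, so maximality forbids that it be new. *)
pose G u : set H := fun v => F u v \/ (u = x /\ v = y).
apply: (maxF G) => [u v u' v' [Fu|[-> ->]] [Fv|[-> ->]]|].
- exact: mF.
- by have := xy _ _ Fu; rewrite !ipE; lra.
- exact: xy.
- by rewrite !subrr ip0r.
split=> [[u v] ?|GF]; first by left.
by apply: nFxy; apply: (GF (x, y)); right.
Qed.

Lemma maximal_monotone_nonempty F : setmap_maximal_monotone ip F ->
  exists u v, F u v.
Proof.
move=> maxF; apply: contrapT => F0; apply: (F0); exists 0, 0.
by apply: maximal_monotone_mem maxF _ => u v Fuv; case: F0; exists u, v.
Qed.

Theorem minty F (lam : R) z : setmap_maximal_monotone ip F -> 0 < lam ->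
  exists u, F u (lam^-1 *: (z - u)).
Proof.
(* For this rescaled and shifted map, the common point [x] makes [(x, lam^-1 *: (z - x))]
   monotonically related to the graph of [F]. *)
move=> maxF lam0; pose G u : set H := [set lam *: v - z | v in F u].
have mG : setmap_monotone ip G.
  move=> u u' _ _ [v Fv <-] [v' Fv' <-].
  rewrite opprB addrA subrK -scalerBr ipZl pmulr_rge0 //.
  exact: maxF.1 Fv Fv'.
have G0 : exists u v, G u v.
  have [u [v Fuv]] := maximal_monotone_nonempty maxF.
  by exists u; exists (lam *: v - z); exists v.
have [x xP] := monotone_related_point mG G0.
exists x; apply: maximal_monotone_mem maxF _ => u v Fuv.
have /xP : G u (lam *: v - z) by exists v.
have -> : x + (lam *: v - z) = - (lam *: (lam^-1 *: (z - x) - v)).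
  by rewrite (scalerBr lam) scalerKV ?gt_eqF // !opprB addrCA.
by rewrite ipNl ipZl oppr_le0 pmulr_rge0.
Qed.

(** * Perturbation by a nonsymmetric positive definite operator *)

(** Solvability of the resolvent equations is assumed instead of maximality, so that the zero map
    can be fed in directly to invert [A]. *)
Lemma monotone_add_surjective F A (c : R) z : setmap_monotone ip F ->
  (forall (lam : R) w, 0 < lam -> exists u, F u (lam^-1 *: (w - u))) ->
  bounded_operator A -> 0 < c -> (forall u, c * `|u| ^+ 2 <= ip (A u) u) ->
  exists u, F u (z - A u).
Proof.
move=> mF resF [M AM] c0 Apos.
(* [K] bounds [A] and dominates [c], so [r <= 1]. The step [lam = c / K ^+ 2] gives |e - lam A e|^2
   <= (1 - r^2) |e|^2. *)
pose K := `|M| + c; have K0 : 0 < K by rewrite ltr_wpDl.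
pose r := c / K; have r0 : 0 < r by rewrite divr_gt0.
have r1 : r <= 1 by rewrite ler_pdivrMr // mul1r lerDr.
pose lam := r / K; have lam0 : 0 < lam by rewrite divr_gt0.
have /choice[J JP] := fun w => resF lam w lam0.
have J1 w w' : `|J w - J w'| <= `|w - w'|.
  rewrite normr_le_ip; have := mF _ _ _ _ (JP w) (JP w').
  rewrite -scalerBr ipZl pmulr_rge0 ?invr_gt0 // opprD addrACA -opprD.
  by rewrite (ipDl (w - w')) ipNl; have := ip_young (w - w') (J w - J w'); lra.
pose f u := J (u - lam *: A u + lam *: z).
(* A rational stand-in for the square root of 1 - r^2, since q^2 = 1 - r^2 + r^4 / 4. *)
pose q := 1 - r ^+ 2 / 2.
have r2 : 0 < r ^+ 2 <= 1 by rewrite exprn_gt0 // expr_le1 // ltW.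
have q0 : 0 <= q by rewrite /q; lra.
have contr : contraction (NngNum q0) [fun of totalfun f].
  split; first by rewrite /= /q; lra.
  move=> [u u'] _ /=; rewrite /totalfun_ /f.
  apply: le_trans (J1 _ _) _.
  have -> : u - lam *: A u + lam *: z - (u' - lam *: A u' + lam *: z)
            = (u - u') - lam *: A (u - u').
    by rewrite linearB /= scalerBr !opprD !opprK addrACA subrr addr0 addrACA.
  move: (u - u') => e.
  rewrite -ler_sqr ?nnegrE ?mulr_ge0 // exprMn -!ip_norm !ipE.
  have Ae : `|A e| ^+ 2 <= K ^+ 2 * `|e| ^+ 2.
    rewrite -exprMn ler_sqr ?nnegrE ?mulr_ge0 ?(ltW K0) //.
    by apply: le_trans (AM e) _; rewrite ler_wpM2r // ler_wpDr ?ler_norm ?ltW.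
  have h1 : lam ^+ 2 * ip (A e) (A e) <= r ^+ 2 * ip e e.
    rewrite [ip (A e) _]ip_norm ip_norm.
    apply: le_trans (ler_wpM2l (sqr_ge0 lam) Ae) _.
    by rewrite mulrA -exprMn /lam divfK ?gt_eqF.
  have h2 : r ^+ 2 * ip e e <= lam * ip (A e) e.
    apply: le_trans (ler_wpM2l (ltW lam0) (Apos e)).
    by rewrite mulrA ip_norm [lam * c]mulrAC -[r * c / K]mulrA -expr2.
  have h3 : 0 <= (r ^+ 2) ^+ 2 * ip e e by rewrite mulr_ge0 ?sqr_ge0 ?ip_ge0.
  rewrite (ipC e (A e)) /q; lra.
have fc : is_contraction [fun of totalfun f] by exists (NngNum q0).
have [|u _ uE] := banach_fixed_point fc closedT; first by exists 0.
exists u; have := JP (u - lam *: A u + lam *: z).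
rewrite -/(f u) -[f u]/(totalfun f u) -uE.
rewrite [_ - u]addrC !addrA addNr add0r [_ + lam *: z]addrC -scalerBr.
by rewrite scalerK ?gt_eqF.
Qed.

(** Values exist by surjectivity of [A + F]; they are unique because two of them, [u] and [w],
    satisfy c |u - w|^2 <= 0. *)
Lemma resolvent_wrt_fun F A : setmap_maximal_monotone ip F ->
  bounded_operator A -> positive_definite ip A ->
  exists JA : H -> H, resolvent_wrt A F = setmap_of_fun JA.
Proof.
move=> maxF bA [c c0 Apos].
have /choice[J JP] z : exists u, F u (z - A u).
  by apply: (monotone_add_surjective z maxF.1 _ bA c0 Apos) => lam w; exact: minty.
exists J; apply/funext => z; apply/seteqP; split=> u /=; last first.
  move=> ->; exists (A (J z)) => //; exists (z - A (J z)) => //.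
  by rewrite addrC subrK.
move=> [_ -> [v Fv Auv]]; rewrite /setmap_of_fun /=.
have := JP z; move: (J z) => w Fw.
apply/eqP; rewrite -subr_eq0 -normr_eq0 -sqrf_eq0.
have := maxF.1 _ _ _ _ Fv Fw; rewrite -Auv.
have -> : v - (A u + v - A w) = - A (u - w).
  by rewrite (raddfB A) !opprB addrC opprD addrA subrK.
rewrite ipNl oppr_ge0 => h.
rewrite eq_le sqr_ge0 andbT -(pmulr_rle0 _ c0).
by apply: le_trans (Apos _) _.
Qed.

Lemma linear_inverse A (c : R) : bounded_operator A -> 0 < c ->
  (forall u, c * `|u| ^+ 2 <= ip (A u) u) ->
  exists E : {linear H -> H},
    [/\ cancel E A, cancel A E, bounded_operator E & positive_definite ip E].
Proof.
move=> bA c0 Apos.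
have zero_mono : setmap_monotone ip (setmap_of_fun (fun=> 0)).
  by move=> u v _ _ -> ->; rewrite subrr ipC ip0r.
have /choice[E AE] z : exists u, A u = z.
  have res0 (lam : R) w : 0 < lam ->
      exists u, setmap_of_fun (fun=> 0) u (lam^-1 *: (w - u)).
    by exists w; rewrite /setmap_of_fun /= subrr scaler0.
  have [u /eqP] := monotone_add_surjective z zero_mono res0 bA c0 Apos.
  by rewrite subr_eq0 => /eqP; exists u.
have A_inj : injective A.
  move=> u v Auv; apply/eqP; rewrite -subr_eq0 -normr_eq0 -sqrf_eq0.
  have := Apos (u - v); rewrite (raddfB A) /= Auv subrr ipC ip0r pmulr_rle0 // => h.
  by rewrite eq_le h sqr_ge0.
have Elin : linear E by move=> a u v; apply: A_inj; rewrite linearP !AE.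
pose E' : {linear H -> H} :=
  HB.pack E (GRing.isLinear.Build _ _ _ _ E Elin).
exists E'; split => //=.
- by move=> u; apply: A_inj; rewrite /= AE.
(* Coercivity at [E z] reads c |E z|^2 <= <z, E z>; Young's inequality turns this into the bound. *)
- exists c^-1 => z; rewrite -ler_sqr ?nnegrE ?mulr_ge0 ?invr_ge0 ?(ltW c0) //.
  rewrite exprMn -!ip_norm.
  have := Apos (E z); rewrite AE -ip_norm => h.
  have := ip_young (c^-1 *: z) (E z); rewrite !ipE => h'.
  have : ip (E z) (E z) <= c^-1 * ip z (E z).
    by rewrite mulrC ler_pdivlMr // mulrC.
  by move: (c^-1) h' => d; lra.
have [M AM] := bA; pose K := `|M| + 1; have K0 : 0 < K by rewrite ltr_wpDl.
(* Combine <E z, z> >= c |E z|^2 with |z| = |A (E z)| <= K |E z|. *)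
exists (c / K ^+ 2); first by rewrite divr_gt0 // exprn_gt0.
move=> z; have := Apos (E z); rewrite AE ipC; apply: le_trans.
rewrite -mulrA ler_pM2l // mulrC ler_pdivrMr ?exprn_gt0 // mulrC -exprMn.
rewrite ler_sqr ?nnegrE ?mulr_ge0 ?(ltW K0) // -{1}(AE z).
by apply: le_trans (AM _) _; rewrite ler_wpM2r // ler_wpDr ?ler_norm.
Qed.

End Hilbert.

(** * The change of variables *)

Theorem lemma3 (R : realType) (H : completeNormedModType R)
    (ip : {dot H for (@idfun R)}) (ip_norm : forall u : H, ip u u = `|u| ^+ 2)
    (F : H -> set H) (D : {linear H -> H}) (x : H) (gamma : R) :
  setmap_maximal_monotone ip F ->
  setmap_monotone ip (setmap_of_fun D) -> bounded_operator D ->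
  0 < gamma ->
  let B := setmap_inv (setmap_add (setmap_inv F) (setmap_of_fun D)) in
  exists E : {linear H -> H},
    [/\ setmap_inv (setmap_of_fun (fun u => gamma *: u + D u))
          = setmap_of_fun E,
        bounded_operator E,
        positive_definite ip E
      & exists2 JE : H -> H, resolvent_wrt E F = setmap_of_fun JE
          & forall y : H, resolvent (setmap_scale gamma B) x = [set y]
              <-> y = E (gamma *: JE (E x) + D x)].
Proof.
move=> maxF mD [M DM] gamma0 B.
have [A AE] : exists A : {linear H -> H}, forall u, A u = gamma *: u + D u.
  by exists (gamma \*: idfun \+ D).
have bA : bounded_operator A.
  exists (gamma + M) => u; rewrite AE mulrDl; apply: le_trans (ler_normD _ _) _.
  by rewrite lerD // normrZ gtr0_norm.
have Apos u : gamma * `|u| ^+ 2 <= ip (A u) u.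
  rewrite AE ipDl ipZl ip_norm lerDl.
  by have := mD u 0 _ _ erefl erefl; rewrite linear0 !subr0.
have [E [EK KE bE posE]] := linear_inverse ip_norm bA gamma0 Apos.
have [J JE] := resolvent_wrt_fun ip_norm maxF bE posE.
have JP z u : F u (z - E u) <-> u = J z.
  have -> : (u = J z) = resolvent_wrt E F z u by rewrite JE.
  split=> [Fu|[_ -> [v Fv <-]]]; last by rewrite addrC addKr.
  by exists (E u) => //; exists (z - E u) => //; rewrite addrC subrK.
exists E; split => //.
  apply/funext => z; apply/seteqP; split=> u; rewrite /setmap_inv /setmap_of_fun /= -AE.
    by move=> ->; rewrite KE.
  by move=> ->; rewrite EK.
exists J => // y; set y0 := E _.
(* Both directions of the equivalence follow once the resolvent at [x] is the singleton of [y0]. *)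
suff -> : resolvent (setmap_scale gamma B) x = [set y0].
  split=> [/seteqP[_ /(_ y erefl)]//|->//].
apply/seteqP; split=> {}y.
  move=> [_ -> [_ [b [u Fub [_ -> uDb]] <-] yx]].
  have Exu : b = E x - E u.
    rewrite -linearB -[b]KE; congr (E _); rewrite AE -yx -uDb.
    by rewrite /= [RHS]addrC -!addrA addKr addrC.
  have uJ : u = J (E x) by apply/JP; rewrite -Exu.
  have Dx : D x = D y + gamma *: D b by rewrite -yx raddfD /= linearZ_LR.
  rewrite /y0 -uJ /= -[LHS]KE; congr (E _); rewrite AE Dx -{1}uDb scalerDr.
  by rewrite -addrA [gamma *: D b + _]addrC.
(* Conversely, the forward computation dictates [u] and [b]; the identity y0 + gamma b = x is
   checked after applying the injective [A]. *)
move=> ->; pose u := J (E x); pose b := E x - E u.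
have Fub : F u b by apply/JP.
have Ay0 : A y0 = gamma *: u + D x by rewrite /y0 EK.
have Ab : A b = x - u by rewrite /b -raddfB EK.
have yx : y0 + gamma *: b = x.
  apply: (can_inj KE); rewrite raddfD /= linearZ_LR /= Ay0 Ab [RHS]AE scalerBr.
  by rewrite addrC addrA subrK.
exists y0 => //; exists (gamma *: b) => //; exists b => //.
exists u => //; exists (D b) => //.
apply: (addIr (gamma *: b)).
by rewrite yx -[x](subrK u) -Ab AE addrC addrA addrAC.
Qed.
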